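(* Let $S$ be an ordered semigroup. Then $S$ is a nil extension of a Clifford ordered semigroup if and only if both of the following conditions hold: (1) for all $x, a, y \in S$ there exists $n \in \mathbb{N}$ such that $xa^{n}y \in (xa^{n}ySya^{n}x] \cap (ya^{n}xSxa^{n}y]$; and (2) for all $a \in S$ and $b \in Reg_\leq(S)$, if $a \leq b$ then $a \in (Sab]$.
   Context: $\mathbb{N}$ is the set of natural numbers (positive integers). An ordered semigroup $(S,\cdot,\leq)$ is a (nonempty) partially ordered set $(S,\leq)$ together with a semigroup structure $(S,\cdot)$ such that for all $a,b,x \in S$, $a \leq b$ implies $xa \leq xb$ and $ax \leq bx$. For $H \subseteq S$, $(H] = \{t \in S : t \leq h \text{ for some } h \in H\}$. For elements $u,v \in S$, $uSv = \{usv : s \in S\}$ and $Su = \{su : s \in S\}$. A nonempty subset $I \subseteq S$ is an ideal of $S$ if $SI \subseteq I$, $IS \subseteq I$ and $(I] = I$. $S$ is a nil extension of an ideal $I$ if the Rees factor ordered semigroup $S/I$ is nil (every element has some power equal to zero); equivalently, for every $a \in S$ there exists $m \in \mathbb{N}$ with $a^m \in I$. ''$S$ is a nil extension of a Clifford ordered semigroup'' means that there is an ideal $K$ of $S$ such that $S$ is a nil extension of $K$ and $K$, with the restricted operation and order, is a Clifford ordered semigroup. $Reg_\leq(S) = \{a \in S : a \in (aSa]\} = \{a \in S : a \leq axa \text{ for some } x \in S\}$ is the set of regular elements of $S$. $S$ is regular if $S = Reg_\leq(S)$. A Clifford ordered semigroup is a regular ordered semigroup $K$ such that for all $a, b \in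 K$, $ab \in (bKa]$, i.e. there is $x \in K$ with $ab \leq bxa$. *)

(* Defs.v *)
From HB Require Import structures.
From mathcomp Require Import all_boot all_order.
From mathcomp Require Import boolp classical_sets.

Set Implicit Arguments.
Unset Strict Implicit.
Unset Printing Implicit Defensive.

Import Order.TTheory.
Import Algebra.

Local Open Scope order_scope.
Local Open Scope classical_set_scope.
Local Open Scope group_scope.

HB.mixin Record isOrderedSemigroup d S of Semigroup S & Order.POrder d S := {
  osg_nonempty : [set: S] !=set0;
  le_mulg2l : forall x a b : S, a <= b -> x * a <= x * b;
  le_mulg2r : forall x a b : S, a <= b -> a * x <= b * x
}.

#[short(type="orderedSemigroupType")]
HB.structure Definition OrderedSemigroup d :=
  { S of Semigroup S & Order.POrder d S & isOrderedSemigroup d S }.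

(* The library's [x ^+ n] needs a unit. Here [spow a n] is the n-fold product
   for n > 0 only; the value [spow a 0 = a] is junk, so every use must carry
   the hypothesis [0 < n]. *)
Definition spow (S : semigroupType) (a : S) (n : nat) : S :=
  iterop n (@mul S) a a.

Section Notions.
Variables (d : Order.disp_t) (S : orderedSemigroupType d).
Implicit Types (H I : set S) (a b u v : S).

Definition downset H : set S := [set t | exists2 h, H h & t <= h].

Definition sandwich u v : set S := [set u * s * v | s in [set: S]].

Definition left_multiples u : set S := [set s * u | s in [set: S]].

Definition Reg : set S := [set a | downset (sandwich a a) a].

Definition regular : Prop := [set: S] = Reg.

Definition clifford : Prop :=
  regular /\ forall a b, downset (sandwich b a) (a * b).

Record is_ideal I : Prop := IsIdeal {
  ideal_neq0 : I !=set0;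
  ideal_mull : [set s * i | s in [set: S] & i in I] `<=` I;
  ideal_mulr : [set i * s | i in I & s in [set: S]] `<=` I;
  ideal_down : downset I = I
}.

Definition is_zero (z : S) : Prop :=
  forall x, [/\ z <= x, z * x = z & x * z = z].

Definition is_nil : Prop :=
  exists2 z, is_zero z & forall a, exists2 m, (0 < m)%N & spow a m = z.

Record ideal := Ideal { ideal_set :> set S; ideal_axiom : is_ideal ideal_set }.

Lemma ideal_mulgl (I : ideal) s i : ideal_set I i -> ideal_set I (s * i).
Proof. by move=> Ii; apply: (ideal_mull (ideal_axiom I)); exists s => //; exists i. Qed.

Lemma ideal_mulgr (I : ideal) s i : ideal_set I i -> ideal_set I (i * s).
Proof. by move=> Ii; apply: (ideal_mulr (ideal_axiom I)); exists i => //; exists s. Qed.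

Lemma ideal_le (I : ideal) a b : a <= b -> ideal_set I b -> ideal_set I a.
Proof. by move=> ab Ib; rewrite -(ideal_down (ideal_axiom I)); exists b. Qed.

End Notions.

Arguments Reg {d} S.

Section IdealSub.
Variables (d : Order.disp_t) (S : orderedSemigroupType d) (I : ideal S).

(* An ideal with the restricted operation and order. *)
Record ideal_sub : Type :=
  IdealSub { ideal_val : S; _ : ideal_val \in (I : set S) }.

Local Notation T := ideal_sub.

HB.instance Definition _ := [isSub for ideal_val].
HB.instance Definition _ := [Choice of T by <:].
HB.instance Definition _ := [SubChoice_isSubPOrder of T by <: with d].

Definition ideal_sub_mul (x y : T) : T :=
  IdealSub (mem_set (ideal_mulgl (val x) (set_mem (valP y)))).

Lemma ideal_sub_mulA : associative ideal_sub_mul.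
Proof. by move=> x y z; apply: val_inj; rewrite /= mulgA. Qed.

HB.instance Definition _ := isSemigroup.Build T ideal_sub_mulA.

Lemma ideal_sub_nonempty : [set: T] !=set0.
Proof.
by have [x Ix] := ideal_neq0 (ideal_axiom I); exists (IdealSub (mem_set Ix)).
Qed.

Lemma ideal_sub_le_mull (x a b : T) : a <= b -> x * a <= x * b.
Proof. exact: le_mulg2l. Qed.

Lemma ideal_sub_le_mulr (x a b : T) : a <= b -> a * x <= b * x.
Proof. exact: le_mulg2r. Qed.

HB.instance Definition _ := isOrderedSemigroup.Build d T
  ideal_sub_nonempty ideal_sub_le_mull ideal_sub_le_mulr.

End IdealSub.

(* The Rees factor S/I on (S \ I) U {0}: [None] is 0, products falling in I
   are 0, and the order is that of S on S \ I, with 0 as least element. *)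
Definition rees d (S : orderedSemigroupType d) (I : ideal S) : Type :=
  option {x : S | x \in ~` (I : set S)}.

Section Rees.
Variables (d : Order.disp_t) (S : orderedSemigroupType d) (I : ideal S).
Local Notation T := (rees I).

HB.instance Definition _ := Choice.copy T (option {x : S | x \in ~` (I : set S)}).

Definition rees_proj (x : S) : T := insub x.

Definition rees_mul (x y : T) : T :=
  match x, y with
  | Some x, Some y => rees_proj (val x * val y)
  | _, _ => None
  end.

Definition rees_le (x y : T) : bool :=
  match x, y with
  | None, _ => true
  | Some _, None => false
  | Some x, Some y => val x <= val y
  end.

Lemma rees_proj_eq0 x : rees_proj x = None <-> ideal_set I x.
Proof.
rewrite /rees_proj; case: insubP => [u /set_mem nIx _|/negP nx].
  by split.
split=> // _; apply: contrapT => nIx; exact: (nx (mem_set nIx)).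
Qed.

Lemma rees_projN x : ~ ideal_set I x ->
  exists2 u : {x : S | x \in ~` (I : set S)}, rees_proj x = Some u & val u = x.
Proof.
move=> nIx; rewrite /rees_proj; case: insubP => [u _ ux|/negP nx]; first by exists u.
by case: nx; apply/mem_set.
Qed.

Lemma rees_projM x y : rees_proj (x * y) = rees_mul (rees_proj x) (rees_proj y).
Proof.
have [/[dup] Ix /rees_proj_eq0 ->|nx] := pselect (ideal_set I x).
  exact/rees_proj_eq0/ideal_mulgr.
have [/[dup] Iy /rees_proj_eq0 ->|ny] := pselect (ideal_set I y).
  have -> : rees_proj (x * y) = None by exact/rees_proj_eq0/ideal_mulgl.
  by case: (rees_proj x).
have [u -> ux] := rees_projN nx; have [v -> vy] := rees_projN ny.
by rewrite /= ux vy.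
Qed.

Lemma rees_proj_surj (u : T) : exists x, u = rees_proj x.
Proof.
case: u => [u|]; first by exists (val u); rewrite /rees_proj valK.
by have [x Ix] := ideal_neq0 (ideal_axiom I); exists x; symmetry; apply/rees_proj_eq0.
Qed.

Lemma rees_mulA : associative rees_mul.
Proof.
move=> u v w.
have [x ->] := rees_proj_surj u; have [y ->] := rees_proj_surj v.
have [z ->] := rees_proj_surj w.
by rewrite -!rees_projM mulgA.
Qed.

HB.instance Definition _ := isSemigroup.Build T rees_mulA.

Lemma rees_le_refl : reflexive rees_le.
Proof. by case=> /=. Qed.

Lemma rees_le_anti : antisymmetric rees_le.
Proof. by case=> [u|] [v|] //= /le_anti /val_inj ->. Qed.

Lemma rees_le_trans : transitive rees_le.
Proof. by case=> [v|] [u|] [w|] //=; exact: le_trans. Qed.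

HB.instance Definition _ := Order.Le_isPOrder.Build d T
  rees_le_refl rees_le_anti rees_le_trans.

Lemma rees_nonempty : [set: T] !=set0.
Proof. by exists None. Qed.

Lemma rees_proj_le x y : x <= y -> rees_le (rees_proj x) (rees_proj y).
Proof.
move=> xy; rewrite /rees_proj; case: insubP => [u nIx ux|//] /=.
case: insubP => [v _ vy|/negP ny] /=; first by rewrite ux vy.
case: ny; apply/mem_set => /= Iy; exact: (set_mem nIx) (ideal_le xy Iy).
Qed.

Lemma rees_le_mull (x a b : T) : a <= b -> x * a <= x * b.
Proof.
by case: x a b => [x|] [a|] [b|] //= ab; apply: rees_proj_le; exact: le_mulg2l.
Qed.

Lemma rees_le_mulr (x a b : T) : a <= b -> a * x <= b * x.
Proof.
by case: x a b => [x|] [a|] [b|] //= ab; apply: rees_proj_le; exact: le_mulg2r.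
Qed.

HB.instance Definition _ := isOrderedSemigroup.Build d T
  rees_nonempty rees_le_mull rees_le_mulr.

End Rees.

Definition nil_extension d (S : orderedSemigroupType d) (I : ideal S) : Prop :=
  is_nil (rees I).

Lemma nil_extensionP d (S : orderedSemigroupType d) (I : ideal S) :
  nil_extension I <->
  forall a : S, exists2 m, (0 < m)%N & ideal_set I (spow a m).
Proof.
have powE (a : S) m : (0 < m)%N ->
    rees_proj I (spow a m) = spow (rees_proj I a : rees I) m.
  case: m => // m _; elim: m => // m IHm.
  by rewrite [spow a _]/(a * spow a m.+1) rees_projM IHm.
have zero0 : is_zero (None : rees I).
  by move=> u; split=> //; case: u.
split=> [[z z0 nilS] a|nilS].
  have [m m0 am] := nilS (rees_proj I a); exists m => //.
  apply/rees_proj_eq0; rewrite powE // am.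
  have [_ <- _] := z0 None; by have [] := zero0 z.
exists None => // u; have [x ->] := rees_proj_surj u.
by have [m m0 /rees_proj_eq0 Im] := nilS x; exists m => //; rewrite -powE.
Qed.

(* Main.v *)
Require Import Defs.
From mathcomp Require Import all_boot all_order.
From mathcomp Require Import boolp classical_sets.

Set Implicit Arguments.
Unset Strict Implicit.
Unset Printing Implicit Defensive.

Import Order.TTheory.
Import Algebra.

Local Open Scope order_scope.
Local Open Scope classical_set_scope.
Local Open Scope group_scope.

(** The two conditions of the statement, with the witnesses made explicit, are
    [power_swap] and [regular_minorant].

    Sufficiency: the ideal is [Reg S]. The point is that a
    one-sided inequality [a <= w * a] already makes [a] regular: it iterates to
    [a <= w ^ n.+1 * a], and [power_swap] for the triple [(w, w, a)] turns the
    bound into an element of [aSa] ([regular_of_le_mull], and its mirror image).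
    A product [e * s] with [e <= e * x * e] satisfies [e * s <= (e * x) * (e * s)],
    so [Reg S] absorbs products on both sides; [regular_minorant] is what makes it
    closed downwards, since [a <= s * a * b] also iterates. The power
    [a * a ^ n * a] is regular by [power_swap] with [x = y = a], so the extension is nil.
    Finally [a * b] is regular and [power_swap] bounds it both by some [b * u] and by some
    [v * a]; using the first bound on the left and the second on the right of
    [a * b <= (a * b) * z * (a * b)] gives [a * b <= b * _ * a].

    Necessity: in a Clifford ideal [K] everything is governed by the relation
    [c] in [(SbS]], written [factor b c]. For [b] and [c] in [K] it is the same
    as [c] in [(Sb]] and the same as [c] in [(bS]] ([clifford_factor_left],
    [clifford_factor_right]), and an element that has [u] and [v] in [K] as
    factors has [u * v] as a factor ([clifford_factor_mul]): the classes of
    mutual factors behave like the semilattice of a semilattice of groups.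
    Moreover [e * y] and [y * e] are factors of each other for [e] in [K] and
    arbitrary [y] in [S]. With [e = a ^ m] in [K], the element [x * e * e * y]
    therefore has the factors [y * e] and [e * x], hence [y * e * e * x]. This
    is why the exponent [2m] is taken rather than [m]: one copy of [e] is needed
    on each side to bring [y] and [x] into [K]. For [regular_minorant], a regular
    [b <= b * x * b] lies below [b * (x * b) ^ m], hence in [K] for some [m];
    so [a <= b] is in [K] too, and swapping [a * z] in
    [a <= (a * z) * a <= (a * z) * b] puts [a] next to [b]. *)

(** * Powers and monotonicity *)

Section OrderedSemigroupTheory.
Variables (d : Order.disp_t) (S : orderedSemigroupType d).
Implicit Types (a b c e p q s u v w x y z : S).

Lemma spowS a n : spow a n.+2 = a * spow a n.+1.
Proof. by []. Qed.

Lemma spowD a m n : spow a (m.+1 + n.+1) = spow a m.+1 * spow a n.+1.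
Proof.
elim: m => [|m IHm]; first by rewrite add1n spowS.
by rewrite spowS -mulgA -IHm !addSn !addnS.
Qed.

Lemma spowSr a n : spow a n.+2 = spow a n.+1 * a.
Proof. by have := spowD a n 0; rewrite addn1. Qed.

Lemma le_mulg a b u v : a <= b -> u <= v -> a * u <= b * v.
Proof.
by move=> ab uv; exact: (le_trans (le_mulg2r u _ _ ab) (le_mulg2l _ _ _ uv)).
Qed.

Lemma le_mulg_between p q a b : a <= b -> p * a * q <= p * b * q.
Proof. by move=> ab; apply/le_mulg2r/le_mulg2l. Qed.

Lemma le_regular_between a z b : a <= a * z * a -> a <= b ->
  a <= (a * z) * b * (z * a).
Proof.
move=> az ab; apply: (le_trans az).
rewrite -mulgA; apply: (le_trans (le_mulg2r (z * a) _ _ az)).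
exact: le_mulg_between.
Qed.

Lemma le_spow_mull w a n : a <= w * a -> a <= spow w n.+1 * a.
Proof.
move=> aw; elim: n => [//|n IHn].
by apply: (le_trans aw); rewrite spowS -mulgA; apply: le_mulg2l.
Qed.

Lemma le_spow_mulr w a n : a <= a * w -> a <= a * spow w n.+1.
Proof.
move=> aw; elim: n => [//|n IHn].
by apply: (le_trans aw); rewrite spowSr mulgA; apply: le_mulg2r.
Qed.

Lemma le_spow_mullr s a b n :
  a <= s * a * b -> a <= spow s n.+1 * a * spow b n.+1.
Proof.
move=> asb; elim: n => [//|n IHn]; apply: (le_trans asb).
rewrite spowS [spow b _]spowSr -2!mulgA.
apply: (le_trans (le_mulg2l _ _ _ (le_mulg2r b _ _ IHn))).
by rewrite !mulgA.
Qed.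

Lemma RegP a : Reg S a <-> exists x, a <= a * x * a.
Proof.
split=> [[_ [x _ <-]]|[x ax]]; first by exists x.
by exists (a * x * a) => //; exists x.
Qed.

Lemma sandwichP u v t :
  downset (sandwich u v) t <-> exists s, t <= u * s * v.
Proof.
split=> [[_ [s _ <-]]|[s ts]]; first by exists s.
by exists (u * s * v) => //; exists s.
Qed.

Lemma left_multiplesP u t :
  downset (left_multiples u) t <-> exists s, t <= s * u.
Proof.
split=> [[_ [s _ <-]]|[s ts]]; first by exists s.
by exists (s * u) => //; exists s.
Qed.

(** * The regular elements form a Clifford ideal *)

Definition power_swap : Prop := forall x a y, exists n,
  (exists s, x * spow a n.+1 * y <=
             x * spow a n.+1 * y * s * (y * spow a n.+1 * x)) /\
  (exists s, x * spow a n.+1 * y <=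
             y * spow a n.+1 * x * s * (x * spow a n.+1 * y)).

Definition regular_minorant : Prop :=
  forall a b, Reg S b -> a <= b -> exists s, a <= s * (a * b).

Lemma power_swapP :
  (forall x a y : S, exists2 n : nat, (0 < n)%N &
      (downset (sandwich (x * spow a n * y) (y * spow a n * x)) `&`
       downset (sandwich (y * spow a n * x) (x * spow a n * y)))
        (x * spow a n * y)) <-> power_swap.
Proof.
split=> sw x a y.
  have [[//|n] _ [/sandwichP l /sandwichP r]] := sw x a y.
  by exists n.
have [n [l r]] := sw x a y.
by exists n.+1 => //; split; apply/sandwichP.
Qed.

Lemma regular_minorantP :
  (forall a b : S, Reg S b -> a <= b ->
     downset (left_multiples (a * b)) a) <-> regular_minorant.
Proof. by split=> mi a b rb ab; apply/left_multiplesP/mi. Qed.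

Section FromConditions.
Hypothesis swap : power_swap.

(** Iterating the hypothesis produces [w ^ n.+1 * a], a word of the form
    [x * w ^ n * y] with [y = a], which [power_swap] bounds by a word that also
    starts with [a]. *)
Lemma regular_of_le_mull w a : a <= w * a -> Reg S a.
Proof.
move=> aw; have [n [_ [s]]] := swap w w a.
rewrite -spowS => le_s; apply/RegP.
exists (spow w n.+1 * w * s * spow w n.+2).
apply: (le_trans (le_spow_mull n.+1 aw)); apply: (le_trans le_s).
by rewrite !mulgA.
Qed.

Lemma regular_of_le_mulr w a : a <= a * w -> Reg S a.
Proof.
move=> aw; have [n [[s le_s] _]] := swap a w w; apply/RegP.
exists (spow w n.+1 * w * s * (w * spow w n.+1)).
apply: (le_trans (le_spow_mulr n.+1 aw)).
by rewrite spowSr mulgA; apply: (le_trans le_s); rewrite !mulgA.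
Qed.

Lemma Reg_mull s e : Reg S e -> Reg S (s * e).
Proof.
move=> /RegP[x ex]; apply: (@regular_of_le_mulr (x * e)).
by apply: (le_trans (le_mulg2l s _ _ ex)); rewrite !mulgA.
Qed.

Lemma Reg_mulr e s : Reg S e -> Reg S (e * s).
Proof.
move=> /RegP[x ex]; apply: (@regular_of_le_mull (e * x)).
by apply: (le_trans (le_mulg2r s _ _ ex)); rewrite !mulgA.
Qed.

(** The factor [b] to the right of [a] is what lets [power_swap] apply: in
    [a <= s ^ n * a * b ^ n] the middle power is the one in [a * b ^ n * b]. *)
Lemma regular_of_le_mullr s a b : a <= s * a * b -> Reg S a.
Proof.
move=> asb; have [n [[t le_t] _]] := swap a b b.
apply: (@regular_of_le_mull
  (spow s n.+2 * (a * spow b n.+1 * b * t * (b * spow b n.+1)))).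
apply: (le_trans (le_spow_mullr n.+1 asb)).
rewrite [spow b n.+2]spowSr -!(mulgA (spow s n.+2)); apply: le_mulg2l.
by rewrite mulgA; apply: (le_trans le_t); rewrite !mulgA.
Qed.

Lemma Reg_le a b : regular_minorant -> a <= b -> Reg S b -> Reg S a.
Proof.
move=> minor ab rb; have [s] := minor _ _ rb ab.
by rewrite mulgA => /regular_of_le_mullr.
Qed.

Lemma Reg_spow a : exists n, Reg S (spow a n.+1).
Proof.
have [n [[s le_s] _]] := swap a a a.
by exists n.+2; apply/RegP; exists s; rewrite spowSr spowS.
Qed.

Lemma Reg_is_ideal : regular_minorant -> is_ideal (Reg S).
Proof.
move=> minor; split.
- have [a _] := @osg_nonempty d S; have [n ra] := Reg_spow a.
  by exists (spow a n.+1).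
- by move=> _ [s _ [e re <-]]; apply: Reg_mull.
- by move=> _ [e re [s _ <-]]; apply: Reg_mulr.
- apply/seteqP; split=> [a [b rb ab]|a ra]; first exact: Reg_le ab rb.
  by exists a.
Qed.

(** Inserting [(p * a) ^ n] between [a] and [b] costs nothing when
    [a <= a * p * a], and it is the middle power that [power_swap] requires. *)
Lemma Reg_mul_swap a b : Reg S a ->
  (exists u, a * b <= b * u) /\ (exists v, a * b <= v * a).
Proof.
move=> /RegP[p ap]; have [n [[s le_s] [t le_t]]] := swap a (p * a) b.
have ab : a * b <= a * spow (p * a) n.+1 * b.
  by apply/le_mulg2r/le_spow_mulr; rewrite mulgA.
split.
- exists (spow (p * a) n.+1 * a * t * (a * spow (p * a) n.+1 * b)).
  by apply: (le_trans ab); apply: (le_trans le_t); rewrite !mulgA.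
- exists (a * spow (p * a) n.+1 * b * s * (b * spow (p * a) n.+1)).
  by apply: (le_trans ab); apply: (le_trans le_s); rewrite !mulgA.
Qed.

End FromConditions.

(** * Clifford ideals *)

(** The Clifford property of [ideal_sub K] read inside [S]. *)
Definition clifford_in (K : set S) : Prop :=
  (forall a, K a -> exists2 x, K x & a <= a * x * a) /\
  (forall a b, K a -> K b -> exists2 x, K x & a * b <= b * x * a).

Lemma ideal_sub_clifford (K : ideal S) :
  clifford (ideal_sub K) <-> clifford_in K.
Proof.
pose inK a (Ka : ideal_set K a) : ideal_sub K := IdealSub (mem_set Ka).
split=> [[regK swapK]|[regK swapK]]; split.
- move=> a Ka; have : Reg (ideal_sub K) (inK a Ka) by rewrite -regK.
  case=> _ [x _ <-] ax.
  by exists (val x); [exact: set_mem (valP x)|exact: ax].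
- move=> a b Ka Kb; have [_ [x _ <-] abx] := swapK (inK a Ka) (inK b Kb).
  by exists (val x); [exact: set_mem (valP x)|exact: abx].
- apply/seteqP; split=> // a _; have [x Kx ax] := regK _ (set_mem (valP a)).
  by exists (a * inK x Kx * a) => //; exists (inK x Kx).
- move=> a b.
  have [x Kx abx] := swapK _ _ (set_mem (valP a)) (set_mem (valP b)).
  by exists (b * inK x Kx * a) => //; exists (inK x Kx).
Qed.

(** In [a * b <= (a * b) * z * (a * b)], the left copy of [a * b] is replaced by
    a bound starting with [b], the right one by a bound ending with [a]. *)
Lemma Reg_clifford (K : ideal S) :
  power_swap -> ideal_set K = Reg S -> clifford_in K.
Proof.
move=> swap defK.
have regK a : ideal_set K a -> exists2 x, ideal_set K x & a <= a * x * a.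
  move=> Ka; have /RegP[x ax] : Reg S a by rewrite -defK.
  (* [x] itself may lie outside the ideal, [x * a * x] does not *)
  exists (x * a * x); first by apply/ideal_mulgr/ideal_mulgl.
  by have := le_regular_between ax (lexx a); rewrite !mulgA.
split=> // a b Ka Kb.
have ra : Reg S a by rewrite -defK.
have [[u le_u] [v le_v]] := Reg_mul_swap swap b ra.
have [z Kz abz] := regK _ (ideal_mulgr b Ka).
exists (u * z * v); first by apply/ideal_mulgr/ideal_mulgl.
apply: (le_trans abz); apply: (le_trans (le_mulg (le_mulg2r z _ _ le_u) le_v)).
by rewrite !mulgA.
Qed.

Definition factor b c : Prop := exists p q, c <= p * b * q.

Section CliffordIdeal.
Variable K : ideal S.
Hypothesis cliffK : clifford_in K.

Let regK a : ideal_set K a -> exists2 x, ideal_set K x & a <= a * x * a.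
Proof. by case: cliffK => regK _; apply: regK. Qed.

Let swapK a b : ideal_set K a -> ideal_set K b ->
  exists2 x, ideal_set K x & a * b <= b * x * a.
Proof. by case: cliffK => _; apply. Qed.

(** In [c <= (c * z) * (p * b * q) * (z * c)], splitting the bound just after [b]
    gives two elements of [K], and swapping them moves [b] to the right end. For
    the mirror statement the bound is split just before [b]. *)
Lemma clifford_factor_left c b : ideal_set K c -> ideal_set K b ->
  factor b c -> exists k, c <= k * b.
Proof.
move=> Kc Kb [p [q cpbq]]; have [z Kz cz] := regK Kc.
have Ku : ideal_set K (c * z * p * b) by apply: ideal_mulgl.
have Kv : ideal_set K (q * z * c) by apply: ideal_mulgl.
have [t _ le_t] := swapK Ku Kv.
exists (q * z * c * t * (c * z * p)).
apply: (le_trans (le_regular_between cz cpbq)).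
by rewrite !mulgA in le_t *.
Qed.

Lemma clifford_factor_right c b : ideal_set K c -> ideal_set K b ->
  factor b c -> exists k, c <= b * k.
Proof.
move=> Kc Kb [p [q cpbq]]; have [z Kz cz] := regK Kc.
have Ku : ideal_set K (c * z * p) by rewrite -mulgA; apply: ideal_mulgr.
have Kv : ideal_set K (b * q * z * c) by apply: ideal_mulgl.
have [t _ le_t] := swapK Ku Kv.
exists (q * z * c * t * (c * z * p)).
apply: (le_trans (le_regular_between cz cpbq)).
by rewrite !mulgA in le_t *.
Qed.

(** The bounds [c <= k * u] and [c <= v * k'] only meet in the product [c * c];
    regularity and the swap [c * z <= z * t * c] recover [c <= (z * t) * (c * c)]. *)
Lemma clifford_factor_mul c u v :
  ideal_set K c -> ideal_set K u -> ideal_set K v ->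
  factor u c -> factor v c -> factor (u * v) c.
Proof.
move=> Kc Ku Kv uc vc; have [z Kz cz] := regK Kc.
have [t _ le_t] := swapK Kc Kz.
have [k ck] := clifford_factor_left Kc Ku uc.
have [k' ck'] := clifford_factor_right Kc Kv vc.
exists (z * t * k), k'; apply: (le_trans cz).
apply: (le_trans (le_mulg2r c _ _ le_t)); rewrite -mulgA.
apply: (le_trans (le_mulg2l (z * t) _ _ (le_mulg ck ck'))).
by rewrite !mulgA.
Qed.

(** A single swap cannot move [e] across [y], which need not lie in the ideal.
    It is done inside the regular product [y * e * h * (y * e)], where [h] is in
    the ideal, so that [e * h] can be swapped to put an [e] in front of [y]. *)
Lemma clifford_factor_comm e y : ideal_set K e ->
  factor (e * y) (y * e) /\ factor (y * e) (e * y).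
Proof.
move=> Ke; split.
- have [h Kh le_h] := regK (ideal_mulgl y Ke).
  have [w _ le_w] := swapK Ke Kh.
  exists (y * h * w), e; apply: (le_trans le_h).
  by have := le_mulg_between y (y * e) le_w; rewrite !mulgA.
- have [h Kh le_h] := regK (ideal_mulgr y Ke).
  have [w _ le_w] := swapK Kh Ke.
  exists e, (w * h * y); apply: (le_trans le_h).
  by have := le_mulg_between (e * y) y le_w; rewrite !mulgA.
Qed.

Lemma factor_trans b a c : factor a b -> factor b c -> factor a c.
Proof.
move=> [p [q ba]] [p' [q' cb]]; exists (p' * p), (q * q').
by apply: (le_trans cb); have := le_mulg_between p' q' ba; rewrite !mulgA.
Qed.

(** [factor] asks for a cofactor on both sides and [S] has no unit, so the missing
    one is supplied by the regularity of [c]. *)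
Lemma factor_of_le_mull c b p : ideal_set K c -> c <= p * b -> factor b c.
Proof.
move=> Kc cpb; have [z _ cz] := regK Kc.
exists p, (z * c); apply: (le_trans cz).
by have := le_mulg2r (z * c) _ _ cpb; rewrite !mulgA.
Qed.

Lemma factor_of_le_mulr c b q : ideal_set K c -> c <= b * q -> factor b c.
Proof.
move=> Kc cbq; have [z _ cz] := regK Kc.
by exists (c * z), q; rewrite -mulgA; exact: (le_trans cz (le_mulg2l _ _ _ cbq)).
Qed.

Lemma clifford_factor_exchange x y e : ideal_set K e ->
  factor (y * (e * e) * x) (x * (e * e) * y).
Proof.
move=> Ke; have Kc : ideal_set K (x * (e * e) * y).
  by apply/ideal_mulgr/ideal_mulgl/ideal_mulgl.
have xe : factor (x * e) (x * (e * e) * y).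
  by apply: (@factor_of_le_mulr _ _ (e * y)) => //; rewrite !mulgA.
have ey : factor (e * y) (x * (e * e) * y).
  by apply: (@factor_of_le_mull _ _ (x * e)) => //; rewrite !mulgA.
have [ex_xe _] := clifford_factor_comm x Ke.
have [_ ye_ey] := clifford_factor_comm y Ke.
have -> : y * (e * e) * x = y * e * (e * x) by rewrite !mulgA.
apply: clifford_factor_mul => //.
- exact: ideal_mulgl.
- exact: ideal_mulgr.
- exact: factor_trans ye_ey ey.
- exact: factor_trans ex_xe xe.
Qed.

Lemma clifford_power_swap : nil_extension K -> power_swap.
Proof.
move=> /nil_extensionP nilK x a y; have [[//|m] _ Ke] := nilK a.
exists (m + m.+1)%N; rewrite -addSn spowD; move: (spow a m.+1) Ke => e Ke.
have Kc : ideal_set K (x * (e * e) * y).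
  by apply/ideal_mulgr/ideal_mulgl/ideal_mulgl.
have Kb : ideal_set K (y * (e * e) * x).
  by apply/ideal_mulgr/ideal_mulgl/ideal_mulgl.
have bc := clifford_factor_exchange x y Ke.
have [k ck] := clifford_factor_left Kc Kb bc.
have [k' ck'] := clifford_factor_right Kc Kb bc.
move: (x * _ * y) (y * _ * x) Kc ck ck' {Kb bc} => c b Kc ck ck'.
have [z _ cz] := regK Kc; split.
- exists (z * k); apply: (le_trans cz).
  by have := le_mulg2l (c * z) _ _ ck; rewrite !mulgA.
- exists (k' * z); apply: (le_trans cz).
  by have := le_mulg2r (z * c) _ _ ck'; rewrite !mulgA.
Qed.

Lemma clifford_regular_minorant : nil_extension K -> regular_minorant.
Proof.
move=> /nil_extensionP nilK a b /RegP[x bx] ab.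
have Ka : ideal_set K a.
  apply: (ideal_le ab); have [[//|m] _ Km] := nilK (x * b).
  apply: (@ideal_le _ _ _ _ (b * spow (x * b) m.+1)); last exact: ideal_mulgl.
  by apply: le_spow_mulr; rewrite mulgA.
have [z Kz az] := regK Ka; have [w _ le_w] := swapK Ka Kz.
exists (z * w); apply: (le_trans az).
by apply: (le_trans (le_mulg le_w ab)); rewrite !mulgA.
Qed.

End CliffordIdeal.
End OrderedSemigroupTheory.

Theorem theorem3p4 (d : Order.disp_t) (S : orderedSemigroupType d) :
  (exists K : ideal S, nil_extension K /\ clifford (ideal_sub K)) <->
  ((forall x a y : S, exists2 n : nat, (0 < n)%N &
      (downset (sandwich (x * spow a n * y) (y * spow a n * x)) `&`
       downset (sandwich (y * spow a n * x) (x * spow a n * y)))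
        (x * spow a n * y)) /\
   (forall a b : S, Reg S b -> a <= b ->
      downset (left_multiples (a * b)) a)).
Proof.
split=> [[K [nilK /ideal_sub_clifford cliffK]]|].
  split; first exact/power_swapP/(clifford_power_swap cliffK).
  exact/regular_minorantP/(clifford_regular_minorant cliffK).
move=> [/power_swapP swap /regular_minorantP minor].
exists (Ideal (Reg_is_ideal swap minor)); split.
  by apply/nil_extensionP => a; have [n ra] := Reg_spow swap a; exists n.+1.
exact/ideal_sub_clifford/(Reg_clifford swap).
Qed.
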